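(* Let $m\in\mathbb{N}$, $m\ge1$, let $A\subseteq\mathbb{N}^m$ be a finite non-empty complete set of multi-indices, for $i=1,\dots,m$ let $n_i=\max_{\alpha\in A}\alpha_i$ and let $p_{0,i},\dots,p_{n_i,i}$ be pairwise distinct real numbers, and let $P_A=\{p_\alpha:\alpha\in A\}$ with $p_\alpha=(p_{\alpha_1,1},\dots,p_{\alpha_m,m})$. Let $L_\alpha\in\Pi_A$, $\alpha\in A$, be the Lagrange polynomials with respect to $P_A$. Let $f:\mathbb{R}^m\to\mathbb{R}$ be a function, and let $\overline P=\{\bar p_1,\dots,\bar p_{|\overline P|}\}\subseteq\mathbb{R}^m$ be any finite set of nodes containing at least one node set $\overline P_A=\{\bar p_\alpha\}_{\alpha\in A}\subseteq\overline P$ (of $|A|$ points) that is unisolvent with respect to $\Pi_A$. Set $\overline F=(f(\bar p_i))_{1\le i\le|\overline P|}\in\mathbb{R}^{|\overline P|}$ and $$R_A=(r_{i,\alpha})\in\mathbb{R}^{|\overline P|\times|A|},\qquad r_{i,\alpha}=L_\alpha(\bar p_i),\quad \bar p_i\in\overline P,\ \alpha\in A.$$ Then the following is true: (i) The Lagrange coefficients $C_{\mathrm{Lag}}=(c_\alpha)_{\alpha\in A}$ of the regression polynomial $Q_{f,A}=\sum_{\alpha\in A}c_\alpha L_\alpha\in\Pi_A$ are uniquely determined by solving $R_AC_{\mathrm{Lag}}\approx\overline F$ by least-squares regression, i.e. the problem $C_{\mathrm{Lag}}=\mathrm{argmin}_{x\in\mathbb{R}^{|A|}}\|R_Ax-\overline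 F\|_2^2$ has a unique solution. (ii) If $f\in\Pi_A$ is a polynomial, then $Q_{f,A}=f$.
   Context: $\mathbb{N}$ contains $0$ when used for multi-indices. $\Pi_A=\mathrm{span}\{x^\alpha:\alpha\in A\}$ is the space of real polynomials in $x_1,\dots,x_m$ spanned by the monomials $x^\alpha=x_1^{\alpha_1}\cdots x_m^{\alpha_m}$, $\alpha\in A$. $A$ is complete (downward closed) if $\alpha\in A$, $\beta\in\mathbb{N}^m$ and $\beta_i\le\alpha_i$ for all $i$ imply $\beta\in A$. A finite non-empty set $P\subseteq\mathbb{R}^m$ is unisolvent with respect to $\Pi_A$ if there is no $Q\in\Pi_A\setminus\{0\}$ with $Q(p)=0$ for all $p\in P$. The node set $P_A$ in the claim is unisolvent with respect to $\Pi_A$, and the Lagrange polynomials with respect to $P_A$ are the unique $L_\alpha\in\Pi_A$ with $L_\alpha(p_\beta)=\delta_{\alpha,\beta}$ (Kronecker delta) for all $\alpha,\beta\in A$; they form a basis of $\Pi_A$. *)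

(* Defs.v *)
From mathcomp Require Import all_boot all_order all_algebra finmap.
From mathcomp Require Import mpoly reals.

Set Implicit Arguments.
Unset Strict Implicit.
Unset Printing Implicit Defensive.

Import Order.TTheory GRing.Theory Num.Theory.

Local Open Scope ring_scope.
Local Open Scope fset_scope.

Definition complete (m : nat) (A : {fset 'X_{1..m}}) : Prop :=
  forall a b : 'X_{1..m},
    a \in A -> (forall i : 'I_m, (b i <= a i)%N) -> b \in A.

Definition max_degree (m : nat) (A : {fset 'X_{1..m}}) (i : 'I_m) : nat :=
  (\max_(a <- A) a i)%N.

Definition in_Pi (R : realType) (m : nat) (A : {fset 'X_{1..m}})
    (q : {mpoly R[m]}) : Prop :=
  exists c : 'X_{1..m} -> R, q = \sum_(a <- A) c a *: 'X_[a].

(* Evaluation at a point of R^m, represented as a row vector. *)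
Definition evalp (R : realType) (m : nat) (q : {mpoly R[m]})
    (x : 'rV[R]_m) : R :=
  q.@[x ord0].

Definition unisolvent (R : realType) (m : nat) (A : {fset 'X_{1..m}})
    (P : {fset 'rV[R]_m}) : Prop :=
  P != fset0 /\
  ~ (exists q : {mpoly R[m]},
       [/\ in_Pi A q, q != 0 & forall x, x \in P -> evalp q x = 0]).

(* [p j i] is the j-th node on the i-th axis; only its values for
   [j <= max_degree A i] matter. *)
Definition grid_node (R : realType) (m : nat) (p : nat -> 'I_m -> R)
    (a : 'X_{1..m}) : 'rV[R]_m :=
  \row_(i < m) p (a i) i.

(* The values of [L] outside of [A] are irrelevant. *)
Definition is_Lagrange (R : realType) (m : nat) (A : {fset 'X_{1..m}})
    (p : nat -> 'I_m -> R) (L : 'X_{1..m} -> {mpoly R[m]}) : Prop :=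
  (forall a, a \in A -> in_Pi A (L a)) /\
  (forall a b, a \in A -> b \in A ->
     evalp (L a) (grid_node p b) = (a == b)%:R).

(* Vectors indexed by [A] are column vectors of size #|{: A}|, the entry [j]
   standing for the multi-index [idx j]. *)
Definition idx (m : nat) (A : {fset 'X_{1..m}}) (j : 'I_#|{: A}|) :
    'X_{1..m} :=
  fsval (enum_val j).

Definition regression_mx (R : realType) (m N : nat) (A : {fset 'X_{1..m}})
    (L : 'X_{1..m} -> {mpoly R[m]}) (x : 'I_N -> 'rV[R]_m) :
    'M[R]_(N, #|{: A}|) :=
  \matrix_(i < N, j < #|{: A}|) evalp (L (idx j)) (x i).

Definition sample (R : realType) (m N : nat) (f : 'rV[R]_m -> R)
    (x : 'I_N -> 'rV[R]_m) : 'cV[R]_N :=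
  \col_(i < N) f (x i).

(* The Euclidean norm: the canonical norm on matrices is the sup norm. *)
Definition norm2 (R : realType) (N : nat) (v : 'cV[R]_N) : R :=
  Num.sqrt (\sum_(i < N) v i ord0 ^+ 2).

Definition is_argmin (R : realType) (T : Type) (g : T -> R) (x : T) : Prop :=
  forall y : T, g x <= g y.

Definition least_squares_solution (R : realType) (N k : nat)
    (M : 'M[R]_(N, k)) (b : 'cV[R]_N) : 'cV[R]_k -> Prop :=
  is_argmin (fun x : 'cV[R]_k => norm2 (M *m x - b) ^+ 2).

Definition Lagrange_comb (R : realType) (m : nat) (A : {fset 'X_{1..m}})
    (L : 'X_{1..m} -> {mpoly R[m]}) (c : 'cV[R]_#|{: A}|) : {mpoly R[m]} :=
  \sum_(j < #|{: A}|) c j ord0 *: L (idx j).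

(* Main.v *)
(** A polynomial [Q] of [Pi_A] that vanishes on the nodes vanishes on the
    unisolvent subset, hence is zero, and so are its Lagrange coefficients
    [Q(p_a)]: [R_A] has trivial kernel. Its Gram matrix is therefore invertible,
    which gives a unique least-squares solution. If [f] is in [Pi_A], its own
    Lagrange coefficients have residual zero, so they are that solution. *)
Require Import Defs.
From mathcomp Require Import all_boot all_order all_algebra finmap.
From mathcomp Require Import mpoly reals.

Set Implicit Arguments.
Unset Strict Implicit.
Unset Printing Implicit Defensive.

Import Order.TTheory GRing.Theory Num.Theory.

Local Open Scope ring_scope.

Lemma norm2_sqr (R : realType) (N : nat) (v : 'cV[R]_N) :
  norm2 v ^+ 2 = (v^T *m v) ord0 ord0.
Proof.
rewrite sqr_sqrtr; last by apply: sumr_ge0 => i _; apply: sqr_ge0.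
by rewrite mxE; apply: eq_bigr => i _; rewrite mxE expr2.
Qed.

Lemma norm2_sqr_eq0 (R : realType) (N : nat) (v : 'cV[R]_N) :
  norm2 v ^+ 2 = 0 -> v = 0.
Proof.
rewrite sqr_sqrtr; last by apply: sumr_ge0 => i _; apply: sqr_ge0.
move/eqP; rewrite psumr_eq0 => [/allP v0|i _]; last exact: sqr_ge0.
apply/colP => i; rewrite mxE; apply/eqP.
by have := v0 i (mem_index_enum i); rewrite /= sqrf_eq0.
Qed.

Lemma norm2_sqrD_orth (R : realType) (N : nat) (u v : 'cV[R]_N) :
  u^T *m v = 0 -> norm2 (u + v) ^+ 2 = norm2 u ^+ 2 + norm2 v ^+ 2.
Proof.
move=> uv0; have vu0 : v^T *m u = 0 by rewrite -[u]trmxK -trmx_mul uv0 trmx0.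
rewrite !norm2_sqr [(u + v)^T]linearD /= mulmxDl !mulmxDr uv0 vu0 addr0 add0r.
by rewrite mxE.
Qed.

(** If a row [z] satisfies [z *m (M^T *m M) = 0], multiplying on the right by [z^T] gives the
    squared norm of [M *m z^T], so [z^T] lies in the kernel of [M]. Applied to the rows of the left
    kernel of the Gram matrix. *)
Lemma gram_unitmx (R : realType) (N k : nat) (M : 'M[R]_(N, k)) :
  (forall x : 'cV[R]_k, M *m x = 0 -> x = 0) -> M^T *m M \in unitmx.
Proof.
move=> Minj; rewrite -row_free_unit -kermx_eq0.
apply/eqP/row_matrixP => i; rewrite row0.
have : row i (kermx (M^T *m M)) *m (M^T *m M) = 0.
  by rewrite -row_mul mulmx_ker row0.
set z := row i _ => z0.
suff : z^T = 0 by move/(congr1 trmx); rewrite trmxK trmx0.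
apply/Minj/norm2_sqr_eq0.
by rewrite norm2_sqr trmx_mul trmxK -mulmxA [M^T *m _]mulmxA mulmxA z0 mul0mx mxE.
Qed.

Lemma least_squares_uniq (R : realType) (N k : nat) (M : 'M[R]_(N, k))
    (b : 'cV[R]_N) :
  (forall x : 'cV[R]_k, M *m x = 0 -> x = 0) ->
  exists! x : 'cV[R]_k, least_squares_solution M b x.
Proof.
move=> Minj; have unitG := gram_unitmx Minj.
(* The solution of the normal equations. *)
pose x0 := invmx (M^T *m M) *m (M^T *m b).
have normal : M^T *m (M *m x0 - b) = 0.
  by rewrite mulmxBr mulmxA mulKVmx // subrr.
(* The residual at [x0] is orthogonal to the column space of [M], which contains [M *m (y - x0)].
   This one identity gives both minimality of [x0] and uniqueness. *)
have pythagoras y :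
    norm2 (M *m y - b) ^+ 2 = norm2 (M *m (y - x0)) ^+ 2 + norm2 (M *m x0 - b) ^+ 2.
  rewrite -norm2_sqrD_orth; first by rewrite mulmxBr addrA subrK.
  by rewrite trmx_mul -mulmxA normal mulmx0.
exists x0; split=> [y|y ymin]; first by rewrite /= (pythagoras y) lerDr sqr_ge0.
(* A second minimizer [y] leaves no room for the first term: [M *m (y - x0)] has norm zero. *)
have := ymin x0; rewrite /= (pythagoras y) gerDr => le0.
have /norm2_sqr_eq0/Minj/eqP : norm2 (M *m (y - x0)) ^+ 2 = 0.
  by apply/eqP; rewrite eq_le le0 sqr_ge0.
by rewrite subr_eq0 => /eqP.
Qed.

Lemma least_squares_exact (R : realType) (N k : nat) (M : 'M[R]_(N, k))
    (x : 'cV[R]_k) :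
  least_squares_solution M (M *m x) x.
Proof.
move=> y; rewrite /= subrr norm2_sqr mulmx0 mxE.
exact: sqr_ge0.
Qed.

Lemma idx_in (m : nat) (A : {fset 'X_{1..m}}) (j : 'I_#|{: A}|) : idx j \in A.
Proof. exact: fsvalP. Qed.

Lemma idx_eq (m : nat) (A : {fset 'X_{1..m}}) (j k : 'I_#|{: A}|) :
  (idx j == idx k) = (j == k).
Proof. by rewrite (inj_eq val_inj) (inj_eq enum_val_inj). Qed.

Lemma big_idx (m : nat) (A : {fset 'X_{1..m}}) (V : nmodType)
    (F : 'X_{1..m} -> V) :
  \sum_(a <- A) F a = \sum_(j < #|{: A}|) F (idx j).
Proof. by rewrite big_seq_fsetE /= big_enum_val. Qed.

Lemma in_PiP (R : realType) (m : nat) (A : {fset 'X_{1..m}})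
    (q : {mpoly R[m]}) :
  in_Pi A q <->
  exists c : 'I_#|{: A}| -> R, q = \sum_(j < #|{: A}|) c j *: 'X_[idx j].
Proof.
split=> [[c ->]|[c ->]]; first by exists (c \o @idx m A); rewrite big_idx.
(* Extends [c] by zero outside [A] without inverting [idx]: as [idx] is injective, the sum has at
   most one term. *)
exists (fun a => \sum_(j < #|{: A}| | idx j == a) c j).
rewrite big_idx; apply: eq_bigr => j _.
by rewrite (big_pred1 j) // => k; rewrite idx_eq.
Qed.

Lemma evalp_sum (R : realType) (m n : nat) (c : 'I_n -> R)
    (q : 'I_n -> {mpoly R[m]}) (x : 'rV[R]_m) :
  evalp (\sum_(j < n) c j *: q j) x = \sum_(j < n) c j * evalp (q j) x.
Proof. by rewrite /evalp raddf_sum /=; apply: eq_bigr => j _; rewrite mevalZ. Qed.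

Lemma in_Pi_sum (R : realType) (m n : nat) (A : {fset 'X_{1..m}})
    (c : 'I_n -> R) (q : 'I_n -> {mpoly R[m]}) :
  (forall j, in_Pi A (q j)) -> in_Pi A (\sum_(j < n) c j *: q j).
Proof.
case/fin_all_exists => d qE; exists (fun a => \sum_(j < n) c j * d j a).
under eq_bigr do rewrite qE scaler_sumr.
rewrite exchange_big; apply: eq_bigr => a _ /=.
by rewrite scaler_suml; apply: eq_bigr => j _; rewrite scalerA.
Qed.

Lemma in_Pi_Lagrange_comb (R : realType) (m : nat) (A : {fset 'X_{1..m}})
    (p : nat -> 'I_m -> R) (L : 'X_{1..m} -> {mpoly R[m]})
    (c : 'cV[R]_#|{: A}|) :
  is_Lagrange A p L -> in_Pi A (Lagrange_comb L c).
Proof. by case=> L_Pi _; apply: in_Pi_sum => j; apply/L_Pi/idx_in. Qed.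

Lemma Lagrange_comb_node (R : realType) (m : nat) (A : {fset 'X_{1..m}})
    (p : nat -> 'I_m -> R) (L : 'X_{1..m} -> {mpoly R[m]})
    (c : 'cV[R]_#|{: A}|) (j : 'I_#|{: A}|) :
  is_Lagrange A p L ->
  evalp (Lagrange_comb L c) (grid_node p (idx j)) = c j ord0.
Proof.
case=> _ L_delta; rewrite evalp_sum (bigD1 j) //= big1 => [|k kj].
  by rewrite L_delta ?idx_in // eqxx mulr1 addr0.
by rewrite L_delta ?idx_in // idx_eq (negbTE kj) mulr0.
Qed.

(* The coefficient matrix of the [L_a] in the monomial basis is a left inverse
   of the square matrix of the values of the monomials at the grid nodes, hence
   also a right inverse: the monomials are combinations of the [L_a]. *)
Lemma Lagrange_comb_span (R : realType) (m : nat) (A : {fset 'X_{1..m}})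
    (p : nat -> 'I_m -> R) (L : 'X_{1..m} -> {mpoly R[m]})
    (q : {mpoly R[m]}) :
  is_Lagrange A p L -> in_Pi A q ->
  exists c : 'cV[R]_#|{: A}|, q = Lagrange_comb L c.
Proof.
case=> L_Pi L_delta /in_PiP[d ->].
have /fin_all_exists[v LE] (j : 'I_#|{: A}|) :
    exists c : 'I_#|{: A}| -> R,
      L (idx j) = \sum_(k < #|{: A}|) c k *: 'X_[idx k].
  by apply/in_PiP/L_Pi/idx_in.
pose V := \matrix_(j, k) v j k.
pose E := \matrix_(k < #|{: A}|, l < #|{: A}|)
  evalp ('X_[idx k] : {mpoly R[m]}) (grid_node p (idx l)).
(* Entry [(j, l)] of [V *m E] is the value of [L (idx j)] at the node of [idx l], a Kronecker
   delta. *)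
have /mulmx1C EV : V *m E = 1%:M.
  apply/matrixP => j l; rewrite !mxE -idx_eq -L_delta ?idx_in // LE evalp_sum.
  by apply: eq_bigr => k _; rewrite !mxE.
(* Row [k] of [E *m V = 1], read as an identity between polynomials. *)
have XE k : 'X_[idx k] = \sum_j E k j *: L (idx j).
  transitivity (\sum_l (E *m V) k l *: 'X_[idx l] : {mpoly R[m]}).
    rewrite EV (bigD1 k) //= mxE eqxx scale1r big1 ?addr0 // => l lk.
    by rewrite mxE eq_sym (negbTE lk) scale0r.
  under eq_bigr do rewrite mxE scaler_suml.
  rewrite exchange_big; apply: eq_bigr => j _ /=.
  by rewrite LE scaler_sumr; apply: eq_bigr => l _; rewrite scalerA [V _ _]mxE.
(* The [j]-th coefficient is the value of the polynomial at the grid node of [idx j]. *)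
exists (\col_j \sum_k d k * E k j); rewrite /Lagrange_comb.
under [RHS]eq_bigr do rewrite mxE scaler_suml.
rewrite exchange_big; apply: eq_bigr => k _ /=.
by rewrite XE scaler_sumr; apply: eq_bigr => j _; rewrite scalerA.
Qed.

(** Translates between vectors and polynomials: a kernel vector of the matrix is a combination of
    the [L a] vanishing at all sample points, and samples of such a combination lie in the column
    space. *)
Lemma mul_regression_mx (R : realType) (m N : nat) (A : {fset 'X_{1..m}})
    (L : 'X_{1..m} -> {mpoly R[m]}) (x : 'I_N -> 'rV[R]_m)
    (c : 'cV[R]_#|{: A}|) :
  regression_mx A L x *m c = sample (evalp (Lagrange_comb L c)) x.
Proof.
apply/colP => i; rewrite !mxE evalp_sum.
by apply: eq_bigr => j _; rewrite mxE mulrC.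
Qed.

Lemma regression_mx_inj (R : realType) (m N : nat) (A : {fset 'X_{1..m}})
    (p : nat -> 'I_m -> R) (L : 'X_{1..m} -> {mpoly R[m]})
    (P : {fset 'rV[R]_m}) (x : 'I_N -> 'rV[R]_m) (c : 'cV[R]_#|{: A}|) :
  is_Lagrange A p L -> unisolvent A P ->
  (forall y, y \in P -> exists i, y = x i) ->
  regression_mx A L x *m c = 0 -> c = 0.
Proof.
move=> LagL [_ unisol] xP; rewrite mul_regression_mx => /colP Qx0.
have Q0 : Lagrange_comb L c = 0.
  have [//|Qn0] := eqVneq (Lagrange_comb L c) 0.
  case: unisol; exists (Lagrange_comb L c); split=> // [|y /xP[i ->]].
    exact: in_Pi_Lagrange_comb LagL.
  by have := Qx0 i; rewrite !mxE.
(* The coefficients are recovered at the grid nodes, which need not be among the sample points. *)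
apply/colP => j; rewrite -(Lagrange_comb_node c j LagL) Q0 mxE.
exact: meval0.
Qed.

Local Open Scope fset_scope.

Theorem corollary5p1 (R : realType) (m : nat) (m_gt0 : (0 < m)%N)
  (A : {fset 'X_{1..m}}) (A_neq0 : A != fset0) (A_complete : complete A)
  (p : nat -> 'I_m -> R)
  (p_distinct : forall (i : 'I_m) (j k : nat),
     (j <= max_degree A i)%N -> (k <= max_degree A i)%N -> j <> k ->
     p j i <> p k i)
  (L : 'X_{1..m} -> {mpoly R[m]}) (L_Lagrange : is_Lagrange A p L)
  (f : 'rV[R]_m -> R)
  (Pbar : {fset 'rV[R]_m}) (pbar : 'I_(#|` Pbar|) -> 'rV[R]_m)
  (pbar_inj : injective pbar)
  (pbar_enum : forall x : 'rV[R]_m, x \in Pbar <-> exists i, x = pbar i)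
  (PbarA_exists : exists PbarA : {fset 'rV[R]_m},
     [/\ PbarA `<=` Pbar, #|` PbarA| = #|` A| & unisolvent A PbarA]) :
  let R_A := regression_mx A L pbar in
  let Fbar := sample f pbar in
  (exists! C : 'cV[R]_#|{: A}|, least_squares_solution R_A Fbar C) /\
  (forall C : 'cV[R]_#|{: A}|, least_squares_solution R_A Fbar C ->
     let Q_fA := Lagrange_comb L C in
     in_Pi A Q_fA /\
     (forall q : {mpoly R[m]}, in_Pi A q ->
        (forall x : 'rV[R]_m, f x = evalp q x) -> Q_fA = q)).
Proof.
move=> R_A Fbar; have [P [/fsubsetP sub _ unisol]] := PbarA_exists.
have R_inj (c : 'cV_#|{: A}|) : R_A *m c = 0 -> c = 0.
  by apply: regression_mx_inj L_Lagrange unisol _ => y /sub/pbar_enum.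
have sol := least_squares_uniq Fbar R_inj; split=> // C solC Q.
split=> [|q q_Pi fq]; first exact: in_Pi_Lagrange_comb L_Lagrange.
have [c qE] := Lagrange_comb_span L_Lagrange q_Pi.
have solc : least_squares_solution R_A Fbar c.
  rewrite (_ : Fbar = R_A *m c); first exact: least_squares_exact.
  by rewrite mul_regression_mx -qE; apply/colP => i; rewrite !mxE.
case: sol => x [_ x_uniq]; rewrite qE /Q.
by rewrite -(x_uniq _ solC) (x_uniq _ solc).
Qed.
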